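(* Let $m,n\ge 0$ be integers and let $\ell$ be an integer with $-n\le \ell\le 1$. Let $\mathcal R^{\ge 1-\ell}_{m,n}$ be the set of partitions $\lambda$ with at most $m$ parts and largest part at most $n$, all of whose successive ranks are at least $1-\ell$. Then \[ \sum_{\lambda\in \mathcal R^{\ge 1-\ell}_{m,n}} t^{d(\lambda)}q^{|\lambda|} =\begin{cases} C_{n+\ell}(q,tq^{-\ell}) & \text{if } \ell \leq m-n,\\[4pt] \displaystyle\sum_{i\ge0} t^i q^{i(i-\ell)}\left(\begin{bmatrix}n+\ell\\ i\end{bmatrix}_q\begin{bmatrix}m\\ i\end{bmatrix}_q-\begin{bmatrix}n+\ell-1\\ i-1\end{bmatrix}_q\begin{bmatrix}m+1\\ i+1\end{bmatrix}_q\right) & \text{otherwise,} \end{cases} \] where for $k\ge 0$ \[ C_k(q,t)=1+\frac{1}{[k]_q}\sum_{i=1}^{k-1}t^iq^{i(i+1)}\begin{bmatrix}k\\ i\end{bmatrix}_q\begin{bmatrix}k\\ i+1\end{bmatrix}_q . \]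
   Context: A partition $\lambda=(\lambda_1\ge\lambda_2\ge\dots\ge\lambda_k)$ is a weakly decreasing (possibly empty) sequence of positive integers; $|\lambda|=\sum_i\lambda_i$; $k$ is its number of parts; $\lambda_i=0$ for $i>k$. The conjugate $\lambda'$ has parts $\lambda'_j=|\{i:\lambda_i\ge j\}|$. The side of the Durfee square is $d(\lambda)=\max\{i\ge 1:\lambda_i\ge i\}$ (and $d(\emptyset)=0$). For $1\le i\le d(\lambda)$, the $i$th successive rank is $r_i(\lambda)=\lambda_i-\lambda'_i$. The empty partition has no ranks, so it satisfies every condition of the form ''all ranks are at least $b$''. Notation: $[n]_q=\frac{1-q^n}{1-q}$, $(q)_n=\prod_{i=1}^n(1-q^i)$, and $\begin{bmatrix}n\\k\end{bmatrix}_q=\frac{(q)_n}{(q)_k(q)_{n-k}}$ if $0\le k\le n$, and $\begin{bmatrix}n\\k\end{bmatrix}_q=0$ otherwise. Here $q,t$ are formal variables. When $k\in\{0,1\}$ the sum in $C_k(q,t)$ is empty, so $C_0=C_1=1$. *)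

(* Defs.v *)
From HB Require Import structures.
From mathcomp Require Import all_boot all_order all_algebra.
Set Implicit Arguments.
Unset Strict Implicit.
Unset Printing Implicit Defensive.
Import Order.TTheory GRing.Theory Num.Theory.
Local Open Scope ring_scope.

Definition is_partition (s : seq nat) : bool :=
  sorted geq s && all (ltn 0) s.

(* Parts are indexed from 1; [part s i = 0] when i > size s. *)
Definition part (s : seq nat) (i : nat) : nat := nth 0%N s i.-1.

Definition conj_part (s : seq nat) (j : nat) : nat := count (leq j) s.

(* The maximum of an empty range is 0, so the Durfee side of [::] is 0. *)
Definition durfee (s : seq nat) : nat :=
  (\max_(1 <= i < (size s).+1 | i <= part s i) i)%N.

Definition succ_rank (s : seq nat) (i : nat) : int :=
  (part s i)%:Z - (conj_part s i)%:Z.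

Definition ranks_ge (b : int) (s : seq nat) : bool :=
  all (fun i => b <= succ_rank s i) (iota 1 (durfee s)).

(* A sequence of at most m entries, each at most n, as a sequence of nat. *)
Definition parts (m n : nat) (s : m.-bseq 'I_n.+1) : seq nat :=
  [seq nat_of_ord x | x <- s].

(* [parts] is injective, so each partition with at most m parts and largest
   part at most n corresponds to exactly one element of m.-bseq 'I_n.+1. *)
Definition ranked_partitions (m n : nat) (b : int) : {set m.-bseq 'I_n.+1} :=
  [set s : m.-bseq 'I_n.+1 | is_partition (parts s) && ranks_ge b (parts s)].

Section QAnalogues.
Variable F : fieldType.
Implicit Types q t : F.

Definition qint q (n : nat) : F := (1 - q ^+ n) / (1 - q).

Definition qpoch q (n : nat) : F := \prod_(1 <= i < n.+1) (1 - q ^+ i).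

(* Integer arguments, so that the convention "0 unless 0 <= k <= n" also
   covers n = -1 and k = -1. *)
Definition qbinom q (n k : int) : F :=
  if (0 <= k) && (k <= n) then
    qpoch q (absz n) / (qpoch q (absz k) * qpoch q (absz (n - k)%R))
  else 0.

(* For k <= 1 the sum is empty; in particular the junk value (qint q 0)^-1 = 0
   is irrelevant. *)
Definition Cpoly (k : nat) q t : F :=
  1 + (qint q k)^-1 *
    \sum_(1 <= i < k)
      t ^+ i * q ^+ (i * i.+1) * qbinom q k%:Z i%:Z * qbinom q k%:Z i.+1%:Z.

Definition rank_term (m n : nat) (l : int) q t (i : nat) : F :=
  t ^+ i * q ^ (i%:Z * (i%:Z - l)) *
    (qbinom q (n%:Z + l) i%:Z * qbinom q m%:Z i%:Z
     - qbinom q (n%:Z + l - 1) (i%:Z - 1) * qbinom q (m%:Z + 1) (i%:Z + 1)).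

(* Hence the sum of [rank_term] over all i >= 0 is its sum over i <= m. *)
Lemma rank_term_eq0 (m n : nat) (l : int) q t (i : nat) :
  (m < i)%N -> rank_term m n l q t i = 0.
Proof.
move=> lt_mi; rewrite /rank_term /qbinom.
have -> : (i%:Z <= m%:Z) = false by rewrite lez_nat leqNgt lt_mi.
have -> : (i%:Z + 1 <= m%:Z + 1) = false by rewrite lerD2r lez_nat leqNgt lt_mi.
by rewrite !andbF !mulr0 subr0 mulr0.
Qed.

End QAnalogues.

(* The field Q(q, t) of rational functions in two formal variables. *)
Definition Qqt : fieldType := {fraction {poly {poly rat}}}.
Definition qvar : Qqt := tofrac (('X : {poly rat})%:P).
Definition tvar : Qqt := tofrac ('X : {poly {poly rat}}).

(* Main.v *)
(* Write c = 1 - l and N = n - c.  Deleting the first row and the first column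
   of a nonempty partition lowers the Durfee side by one and deletes the first
   successive rank, so the generating function P(m, n) satisfies
     P(m, n) = 1 + \sum_(x < n, k < m, k + c <= x) t q^(x + k + 1) P(k, x),
   a recursion equivalent to prescribing the mixed second difference of P in m
   and n together with P(m, n) = P(N, n) for m >= N.  In terms of
   u(N, i) = q^(i(i-1)/2) [N, i]_q, which satisfies
   u(N+1, i+1) = u(N, i+1) + q^N u(N, i), the solution for m <= N + 1 is
     \sum_i (t q^(c+1))^i (u(N, i) u(m, i) - u(N, i-1) u(m, i+1)).
   The q-Pascal rule turns this into the second formula of the theorem; for
   m = N the difference is a q-Narayana number, which gives C_(N+1). *)
Require Import Defs.
From mathcomp Require Import all_boot all_order all_algebra.
From mathcomp Require Import zify ring.
Set Implicit Arguments.
Unset Strict Implicit.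
Unset Printing Implicit Defensive.
Import Order.TTheory GRing.Theory Num.Theory.
Local Open Scope ring_scope.

(* Adds to s a first row of length x + 1 and a first column of length k + 1. *)
Definition hook (x k : nat) (s : seq nat) : seq nat :=
  x.+1 :: ([seq i.+1 | i <- s] ++ nseq (k - size s) 1%N).

(** Plain lists forget the box (m, n), so members of different boxes can be related in the hook
    recursion. *)
Definition ranked_seqs (m n : nat) (b : int) : seq (seq nat) :=
  [seq parts s | s in ranked_partitions m n b].

Lemma parts_inj m n : injective (@parts m n).
Proof. by move=> s1 s2 /(inj_map val_inj) /val_inj. Qed.

Lemma ranked_seqs_uniq m n b : uniq (ranked_seqs m n b).
Proof. by rewrite map_inj_uniq ?enum_uniq //; apply: parts_inj. Qed.

Lemma mem_ranked_seqs m n b s :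
  (s \in ranked_seqs m n b) =
  [&& is_partition s, ranks_ge b s, (size s <= m)%N & all (leq^~ n) s].
Proof.
apply/mapP/and4P => [[u]|[ps rs sm sn]].
  rewrite mem_enum inE => /andP[pu ru] ->; split => //.
    by rewrite size_map size_bseq.
  by apply/allP => _ /mapP[i _ ->]; rewrite -ltnS.
have hs : (size [seq inord i : 'I_n.+1 | i <- s] <= m)%N by rewrite size_map.
have e : parts (Bseq hs) = s.
  rewrite /parts /= -map_comp -[RHS]map_id; apply/eq_in_map => i /(allP sn) Hi.
  by rewrite /= inordK.
by exists (Bseq hs); rewrite // mem_enum inE e ps.
Qed.

(** * Durfee side and successive ranks under adding a hook *)

Lemma bigmax_succ (r : seq nat) (P : pred nat) :
  maxn 1 (\max_(i <- r | P i) i.+1) = (\max_(i <- r | P i) i).+1.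
Proof.
elim: r => [|i r IH]; first by rewrite !big_nil.
by rewrite !big_cons; case: (P i); rewrite // -maxnSS -IH maxnCA.
Qed.

Lemma durfee_widen s k : (size s <= k)%N ->
  durfee s = (\max_(1 <= i < k.+1 | i <= part s i) i)%N.
Proof.
move=> sk; rewrite /durfee [RHS](@big_cat_nat _ _ _ (size s).+1) //= ?ltnS //.
rewrite [X in maxn _ X]big1_seq ?maxn0 // => i.
by case: i => // i; rewrite mem_index_iota /part => /andP[+ /andP[h _]]; rewrite nth_default.
Qed.

Lemma durfee_le_size s : (durfee s <= size s)%N.
Proof.
by rewrite /durfee big_seq_cond; apply/bigmax_leqP_seq => i; rewrite mem_index_iota; lia.
Qed.

Lemma durfee_le_bound n s : all (leq^~ n) s -> (durfee s <= n)%N.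
Proof.
move=> /allP sn; rewrite /durfee big_seq_cond.
apply/bigmax_leqP_seq => i _; rewrite mem_index_iota => /andP[/andP[i0 i1] /leq_trans].
by apply; apply/sn/mem_nth; rewrite -ltnS prednK.
Qed.

Lemma sumn_hook x k s : (size s <= k)%N ->
  sumn (hook x k s) = (x + k + 1 + sumn s)%N.
Proof.
move=> sk; rewrite /= sumn_cat sumn_nseq.
have -> : sumn [seq i.+1 | i <- s] = (size s + sumn s)%N.
  by elim: s {sk} => //= i s ->; lia.
lia.
Qed.

Lemma size_hook x k s : (size s <= k)%N -> size (hook x k s) = k.+1.
Proof. by move=> sk; rewrite /= size_cat size_map size_nseq; lia. Qed.

Lemma part_hook x k s i : (0 < i <= size s)%N ->
  part (hook x k s) i.+1 = (part s i).+1.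
Proof.
by case: i => // i /= si; rewrite /part /= nth_cat size_map si (nth_map 0%N).
Qed.

Lemma part_hook_large x k s i : (size s < i)%N -> (part (hook x k s) i.+1 <= 1)%N.
Proof.
case: i => // i; rewrite ltnS => si; rewrite /part /= nth_cat size_map ltnNge si /=.
by rewrite nth_nseq; case: ifP.
Qed.

(** Index 1 always passes the test. Index i + 1 passes for the hook exactly when i passes for [s],
    because rows i + 1 with i > [size s] have length at most 1. *)
Lemma durfee_hook x k s : (size s <= k)%N -> durfee (hook x k s) = (durfee s).+1.
Proof.
move=> sk; rewrite (durfee_widen sk) /durfee size_hook // -bigmax_succ.
rewrite big_ltn_cond //= big_add1 /=; congr maxn.
rewrite big_seq_cond [RHS]big_seq_cond; apply: eq_bigl => i.
rewrite mem_index_iota; case: (boolP (_ <= _ < _)%N) => //= ik.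
case: (leqP i (size s)) => si; first by rewrite part_hook //; lia.
have := part_hook_large x k si; rewrite /part (nth_default _ (s := s)); lia.
Qed.

Lemma conj_part_hook x k s i : (0 < i <= x)%N ->
  conj_part (hook x k s) i.+1 = (conj_part s i).+1.
Proof.
move=> ix; rewrite /conj_part /= count_cat count_map count_nseq /=.
have -> : (i.+1 <= x.+1)%N by lia.
have -> : (i < 1)%N = false by lia.
by rewrite /= mul0n addn0.
Qed.

(** The first row and column give the rank x - k. Up to the Durfee side of [s], row i + 1 and column
    i + 1 each gain one cell, so the later ranks are those of [s]. *)
Lemma ranks_ge_hook b x k s : (size s <= k)%N -> all (leq^~ x) s ->
  ranks_ge b (hook x k s) = (b <= x%:Z - k%:Z) && ranks_ge b s.
Proof.
move=> sk sx; rewrite /ranks_ge durfee_hook //=; congr andb.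
  rewrite /succ_rank /part /conj_part /=; congr (b <= _).
  rewrite count_cat count_map count_nseq /= mul1n.
  rewrite (eq_count (a2 := predT)) // count_predT subnKC //.
  by rewrite -addn1 !PoszD; ring.
rewrite (iotaDl 1 1) all_map; apply: eq_in_all => i; rewrite mem_iota add1n ltnS.
case/andP=> i0 id; rewrite -[LHS]/(b <= succ_rank (hook x k s) i.+1).
have is_ := leq_trans id (durfee_le_size s).
have ix := leq_trans id (durfee_le_bound sx).
by rewrite /succ_rank part_hook ?conj_part_hook ?i0 // !intS opprD addrACA subrr add0r.
Qed.

(** * Unique hook decomposition of nonempty partitions *)

Lemma is_partition_hook x k s : all (leq^~ x) s -> is_partition s ->
  is_partition (hook x k s).
Proof.
have tr : transitive geq by move=> a b c; rewrite /=; lia.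
move=> sx /andP[]; rewrite /is_partition !sorted_pairwise //= => ss s0.
rewrite pairwise_cat all_cat all_cat pairwise_map !all_map ss /= !all_nseq /=.
rewrite (eq_all (a2 := leq^~ x)) // sx !orbT /=.
have -> : all (preim S (ltn 0)) s by apply/allP.
rewrite /= !andbT; apply/andP; split.
  by apply/allrelP => _ _ /mapP[i _ ->] /nseqP[-> _].
by elim: (k - size s)%N => //= r ->; rewrite all_nseq orbT.
Qed.

Lemma hook_surj x s : is_partition (x :: s) ->
  exists2 u, is_partition u &
    [/\ x :: s = hook x.-1 (size s) u, (size u <= size s)%N & all (leq^~ x.-1) u].
Proof.
have tr : transitive geq by move=> a b c; rewrite /=; lia.
rewrite /is_partition /= !(path_sortedE tr) => /and3P[/andP[xs ss] x0 s0].
suff [u [us u0 [es eu]]] : exists u, [/\ sorted geq u, all (ltn 0) u &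
    s = [seq i.+1 | i <- u] ++ nseq (size s - size u) 1%N /\ (size u <= size s)%N].
  exists u; first by rewrite us.
  split => //; first by rewrite /hook prednK // -es.
  move: xs; rewrite {1}es all_cat all_map => /andP[+ _].
  by apply: sub_all => i /=; lia.
elim: s ss s0 {xs} => [|y s IH] /= ; first by exists [::].
rewrite (path_sortedE tr) => /andP[ys ss] /andP[y0 s0].
have [u [us u0 [es eu]]] := IH ss s0.
(* A part equal to 1 is followed only by ones, so the witness is empty; otherwise y - 1 is
   prepended. *)
case: (ltnP 1 y) => y1; last first.
  exists [::]; split => //; split => //=; congr cons; first by lia.
  apply/all_pred1P/allP => i i_s; have := allP ys _ i_s; have := allP s0 _ i_s.
  by rewrite /=; lia.
exists (y.-1 :: u); split; last 1 first.
- by split; rewrite /= ?subSS -?es ?prednK //; lia.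
- rewrite /= (path_sortedE tr) us andbT.
  move: ys; rewrite {1}es all_cat all_map => /andP[+ _].
  by apply: sub_all => i /=; lia.
by rewrite /= u0 andbT; lia.
Qed.

Lemma hook_inj x k x' k' s s' : (size s <= k)%N -> (size s' <= k')%N ->
  all (ltn 0) s -> all (ltn 0) s' ->
  hook x k s = hook x' k' s' -> [/\ x = x', k = k' & s = s'].
Proof.
move=> sk sk' s0 s0' E.
have := congr1 size E; rewrite !size_hook // => -[ek].
case: E => -> E; split => //.
(* Dropping the ones and lowering the other entries recovers [u] whatever the padding; positivity
   keeps the parts of [u] from being dropped. *)
have K r u : all (ltn 0) u ->
    [seq i.-1 | i <- [seq i.+1 | i <- u] ++ nseq r 1%N & (1 < i)%N] = u.
  rewrite filter_cat map_cat; case: r => [|r]; last first.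
    rewrite (_ : filter _ (nseq _ _) = [::]) ?cats0; first by elim: u => //= -[|i] u IH //= /IH ->.
    by elim: r.
  by rewrite cats0; elim: u => //= -[|i] u IH //= /IH ->.
by rewrite -(K (k - size s)%N s s0) E K.
Qed.

(** The condition k + c <= x is the bound on the first rank; what remains has at most k parts, each
    at most x. *)
Lemma ranked_seqs_rec m n c :
  perm_eq (ranked_seqs m n c%:Z)
    ([::] :: [seq hook xk.1 xk.2 s |
       xk <- [seq (x, k) | x <- iota 0 n, k <- [seq k <- iota 0 m | k + c <= x]%N],
       s <- ranked_seqs xk.2 xk.1 c%:Z]).
Proof.
apply: uniq_perm; first exact: ranked_seqs_uniq.
  rewrite cons_uniq; apply/andP; split.
    by apply/negP => /allpairsPdep[xk [s []]].
  apply: allpairs_uniq_dep => [|xk _|]; first 2 last.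
  - move=> _ _ /allpairsPdep[[x k] [s [_ + ->]]] /allpairsPdep[[x' k'] [s' [_ + ->]]] /=.
    rewrite !mem_ranked_seqs => /and4P[/andP[_ s0] _ sk _] /and4P[/andP[_ s0'] _ sk' _].
    by case/hook_inj => // -> -> ->.
  - apply: allpairs_uniq_dep => [|x _|]; rewrite ?iota_uniq ?filter_uniq ?iota_uniq //.
    by move=> [x k] [x' k'] _ _ /= [-> ->].
  - exact: ranked_seqs_uniq.
move=> s; rewrite mem_ranked_seqs in_cons.
apply/and4P/orP => [[ps rs sm sn]|[/eqP ->|]]; last 2 first.
- by rewrite /ranks_ge /durfee big_geq.
- case/allpairsPdep=> -[x k] [u [/allpairsPdep[x' [k' [hx]]]]].
  rewrite mem_filter => hk [-> ->] /=; rewrite mem_ranked_seqs => /and4P[pu ru uk ux] ->.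
  move: hx hk; rewrite !mem_iota => hx hk; split.
  + exact: is_partition_hook.
  + by rewrite ranks_ge_hook // ru andbT; lia.
  + by rewrite size_hook //; lia.
  + rewrite /= all_cat all_map all_nseq /= orbC; apply/and3P; split; [lia| |lia].
    by apply: sub_all ux => i /=; lia.
case: s ps rs sm sn => [|x s] ps rs sm sn; [by left|right].
have x0 : (0 < x)%N by case/andP: ps => _ /= /andP[].
have [u pu [es us ux]] := hook_surj ps.
rewrite es ranks_ge_hook // in rs; case/andP: rs => cx ru.
apply/allpairsPdep; exists (x.-1, size s), u; split => //=; last first.
  by rewrite mem_ranked_seqs pu ru us ux.
apply/allpairsPdep; exists x.-1, (size s); split => //.
  by case/andP: sn => xn _; rewrite mem_iota; lia.
by rewrite mem_filter mem_iota; move: sm => /=; lia.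
Qed.

(** * Recursion for the generating function and its solution *)

Section GeneratingFunction.
Variable F : fieldType.
Variables (q t : F) (c : nat).

Definition ranked_gf (m n : nat) : F :=
  \sum_(s <- ranked_seqs m n c%:Z) t ^+ durfee s * q ^+ sumn s.

Lemma ranked_gfE m n : ranked_gf m n =
  1 + \sum_(0 <= x < n) \sum_(0 <= k < m | (k + c <= x)%N)
        t * q ^+ (x + k).+1 * ranked_gf k x.
Proof.
rewrite /ranked_gf (perm_big _ (ranked_seqs_rec m n c)) big_cons /=.
rewrite {1}/durfee big_geq // mulr1; congr (_ + _).
rewrite big_allpairs_dep big_allpairs_dep /index_iota !subn0.
apply: eq_bigr => x _; rewrite big_filter; apply: eq_bigr => k _.
rewrite mulr_sumr; apply: eq_big_seq => s.
rewrite mem_ranked_seqs => /and4P[_ _ sk _].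
by rewrite durfee_hook // sumn_hook // addn1 /= exprS !exprD; ring.
Qed.

Lemma ranked_gf0l n : ranked_gf 0 n = 1.
Proof. by rewrite ranked_gfE big1 ?addr0 // => x _; rewrite big_geq. Qed.

Lemma ranked_gf_small m n : (n <= c)%N -> ranked_gf m n = 1.
Proof.
move=> nc; rewrite ranked_gfE big1_seq ?addr0 // => x; rewrite mem_index_iota => hx.
by rewrite big1 // => k; lia.
Qed.

(** Having m + 1 parts and first rank at least c forces a first row longer than m + c >= n. *)
Lemma ranked_gf_stable m n : (n <= m + c)%N -> ranked_gf m.+1 n = ranked_gf m n.
Proof.
move=> nm; rewrite !ranked_gfE; congr (_ + _); apply: eq_big_nat => x hx.
rewrite big_mkcond big_nat_recr //= -big_mkcond /=.
by case: ifP; rewrite ?addr0 //; lia.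
Qed.

(** The mixed difference of the double sum isolates its summand x = n, k = m. *)
Lemma ranked_gf_diff m n : (m + c <= n)%N ->
  ranked_gf m.+1 n.+1 =
  ranked_gf m n.+1 + ranked_gf m.+1 n - ranked_gf m n
    + t * q ^+ (n + m).+1 * ranked_gf m n.
Proof.
move=> mn; rewrite [ranked_gf m.+1 n.+1]ranked_gfE [ranked_gf m n.+1]ranked_gfE.
rewrite [ranked_gf m.+1 n]ranked_gfE [X in _ + _ - X + _]ranked_gfE.
rewrite ![\sum_(0 <= x < n.+1) _]big_nat_recr //=.
have -> (G : nat -> F) : \sum_(0 <= k < m.+1 | (k + c <= n)%N) G k =
    \sum_(0 <= k < m | (k + c <= n)%N) G k + G m.
  by rewrite big_mkcond big_nat_recr //= mn -big_mkcond.
by ring.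
Qed.

(* [elem_gf N i] is the [i]th elementary symmetric polynomial in
   1, q, ..., q^(N-1), that is q^(i(i-1)/2) times the [q]-binomial. *)
Fixpoint elem_gf (N i : nat) : F :=
  match N, i with
  | _, 0 => 1
  | 0, _.+1 => 0
  | N'.+1, i'.+1 => elem_gf N' i'.+1 + q ^+ N' * elem_gf N' i'
  end.

Lemma elem_gf0 N : elem_gf N 0 = 1. Proof. by case: N. Qed.

Lemma elem_gfS N i :
  elem_gf N.+1 i.+1 = elem_gf N i.+1 + q ^+ N * elem_gf N i.
Proof. by []. Qed.

(* Enumerates pairs of i-subsets A of {0..N-1} and B of {0..m-1}, for m <= N + 1,
   such that A dominates B entrywise; the subtracted term is the reflection
   principle, since swapping tails of A and B preserves the sum of all entries. *)
Definition dom_gf (i N m : nat) : F :=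
  if i is j.+1 then
    elem_gf N j.+1 * elem_gf m j.+1 - elem_gf N j * elem_gf m j.+2
  else 1.

Lemma dom_gf_eq1 i N m : (m == 0)%N || (N == 0)%N && (m <= 1)%N ->
  dom_gf i N m = (i == 0)%:R.
Proof.
case: i => //= i; case: m => [|m] /=; first by rewrite !mulr0 subrr.
by case: N m => // -[] // _ /=; case: i => [|i] /=; ring.
Qed.

Lemma dom_gf_stable i N : dom_gf i N N.+1 = dom_gf i N N.
Proof. by case: i => //= i; ring. Qed.

(** The mixed difference of f(N) g(m) is the product of the two differences, which [elem_gfS]
    evaluates. *)
Lemma dom_gf_diff i N m :
  dom_gf i.+1 N.+1 m.+1 =
  dom_gf i.+1 N.+1 m + dom_gf i.+1 N m.+1
    - dom_gf i.+1 N m + q ^+ (N + m) * dom_gf i N m.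
Proof.
by rewrite exprD; case: i => [|i] /=; rewrite ?elem_gf0; ring.
Qed.

Arguments dom_gf : simpl never.

(** Both sides obey the same mixed-difference recursion for m <= N and do not change from m = N to m
    = N + 1. Terms with i > m vanish, so the free bound [B] lets the induction hypotheses be used at
    different lengths. *)
Lemma ranked_gf_dom N m B : (m <= N.+1)%N -> (m < B)%N ->
  ranked_gf m (N + c) = \sum_(0 <= i < B) (t * q ^+ c.+1) ^+ i * dom_gf i N m.
Proof.
have base N' m' B' : (m' == 0)%N || (N' == 0)%N && (m' <= 1)%N -> (m' < B')%N ->
    \sum_(0 <= i < B') (t * q ^+ c.+1) ^+ i * dom_gf i N' m' = 1.
  case: B' => // B' hm _; rewrite big_nat_recl //= expr0 mul1r big1 ?addr0 // => i _.
  by rewrite dom_gf_eq1 // mulr0.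
elim: N m B => [|N IHN] m B mN mB; first by rewrite base ?mN ?orbT // ranked_gf_small.
elim: m B mN mB => [|m IHm] B mN mB; first by rewrite base // ranked_gf0l.
have [mN'|mN'] := leqP m N; last first.
  have em : m = N.+1 by lia.
  rewrite ranked_gf_stable; last by lia.
  rewrite (IHm B); [|lia|lia].
  by apply: eq_bigr => i _; rewrite em dom_gf_stable.
rewrite addSn ranked_gf_diff; last by lia.
(* The correction term carries an extra factor t q^(c+1), which shifts its index, so its sum is one
   term shorter. *)
case: B mB => // B mB.
rewrite [X in _ + _ * X](IHN m B); [|lia|lia].
rewrite -addSn (IHm B.+1) ?(IHN m.+1 B.+1) ?(IHN m B.+1); try lia.
rewrite !(big_nat_recl B 0) //= !expr0 !mul1r big_distrr /=.
have E : \sum_(0 <= i < B) (t * q ^+ c.+1) ^+ i.+1 * dom_gf i.+1 N.+1 m.+1 =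
  \sum_(0 <= i < B) (t * q ^+ c.+1) ^+ i.+1 * dom_gf i.+1 N.+1 m +
  \sum_(0 <= i < B) (t * q ^+ c.+1) ^+ i.+1 * dom_gf i.+1 N m.+1 -
  \sum_(0 <= i < B) (t * q ^+ c.+1) ^+ i.+1 * dom_gf i.+1 N m +
  \sum_(0 <= i < B) t * q ^+ (N + c + m).+1 * ((t * q ^+ c.+1) ^+ i * dom_gf i N m).
  rewrite -sumrN -!big_split /=; apply: eq_bigr => i _.
  rewrite dom_gf_diff exprS (_ : (N + c + m).+1 = (N + m + c.+1)%N); last by lia.
  by rewrite [q ^+ (_ + c.+1)]exprD; ring.
by move: E => /= ->; ring.
Qed.

End GeneratingFunction.

(** * Identities for q-binomials, with q not a root of unity *)

Section QBinomial.
Variable F : fieldType.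
Variable q : F.
Hypothesis q_non_root : forall n, 1 - q ^+ n.+1 != 0.

Lemma qpochS n : qpoch q n.+1 = qpoch q n * (1 - q ^+ n.+1).
Proof. by rewrite /qpoch big_nat_recr. Qed.

Lemma qpoch_neq0 n : qpoch q n != 0.
Proof.
elim: n => [|n IH]; first by rewrite /qpoch big_geq ?oner_eq0.
by rewrite qpochS mulf_neq0.
Qed.

Lemma qbinomE (i j : nat) :
  qbinom q (i + j)%:Z i%:Z = qpoch q (i + j) / (qpoch q i * qpoch q j).
Proof. by rewrite /qbinom lez_nat leq_addr /= PoszD addrAC subrr add0r. Qed.

Lemma qbinom_small (N i : nat) : (N < i)%N -> qbinom q N%:Z i%:Z = 0.
Proof. by move=> Ni; rewrite /qbinom lez_nat leqNgt Ni andbF. Qed.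

Lemma qbinom0 (N : nat) : qbinom q N%:Z 0 = 1.
Proof.
rewrite -[N]add0n (qbinomE 0) add0n /qpoch [\prod_(1 <= i < 1) _]big_geq //.
by rewrite mul1r divff ?qpoch_neq0.
Qed.

Lemma qbinom_absorb_top (N i : nat) :
  (1 - q ^+ i.+1) * qbinom q N.+1%:Z i.+1%:Z = (1 - q ^+ N.+1) * qbinom q N%:Z i%:Z.
Proof.
have [Ni|iN] := ltnP N i; first by rewrite !qbinom_small // !mulr0.
rewrite -(subnKC iN) -addSn !qbinomE addSn !qpochS.
by field; rewrite !qpoch_neq0 q_non_root.
Qed.

Lemma qbinom_absorb_right (N i : nat) : (i <= N)%N ->
  (1 - q ^+ i.+1) * qbinom q N%:Z i.+1%:Z = (1 - q ^+ (N - i)) * qbinom q N%:Z i%:Z.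
Proof.
move=> iN; have [j ->] : exists j, N = (i + j)%N by exists (N - i)%N; rewrite subnKC.
rewrite addKn qbinomE; case: j => [|j].
  by rewrite addn0 qbinom_small // subrr mulr0 mul0r.
rewrite -addSnnS qbinomE !qpochS.
by field; rewrite !qpoch_neq0 !q_non_root.
Qed.

(** After multiplication by 1 - q^(i+1), absorption makes every term a multiple of [N, i]_q. *)
Lemma qbinom_pascal (N i : nat) :
  qbinom q N.+1%:Z i.+1%:Z = q ^+ i.+1 * qbinom q N%:Z i.+1%:Z + qbinom q N%:Z i%:Z.
Proof.
have [Ni|iN] := ltnP N i.
  by rewrite !qbinom_small ?mulr0 ?addr0 // ltnW.
apply: (mulfI (q_non_root i)); rewrite qbinom_absorb_top mulrDr mulrCA.
rewrite qbinom_absorb_right // (_ : q ^+ N.+1 = q ^+ i.+1 * q ^+ (N - i)); first ring.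
by rewrite -exprD addSn subnKC.
Qed.

Lemma qbinom_pascal' (N i : nat) : (i <= N)%N ->
  qbinom q N.+1%:Z i.+1%:Z = qbinom q N%:Z i.+1%:Z + q ^+ (N - i) * qbinom q N%:Z i%:Z.
Proof.
move=> iN; apply: (mulfI (q_non_root i)); rewrite qbinom_absorb_top mulrDr mulrCA.
rewrite qbinom_absorb_right // (_ : q ^+ N.+1 = q ^+ (N - i) * q ^+ i.+1); first ring.
by rewrite -exprD addnS subnK.
Qed.

Lemma elem_gfE N i : elem_gf q N i = q ^+ 'C(i, 2) * qbinom q N%:Z i%:Z.
Proof.
elim: N i => [|N IH] [|i]; rewrite ?elem_gf0 ?qbinom0 ?mulr1 //.
  by rewrite qbinom_small ?mulr0.
rewrite elem_gfS !IH; have [Ni|iN] := ltnP N i.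
  by rewrite !qbinom_small ?mulr0 ?addr0 // ltnW.
rewrite qbinom_pascal' // binS bin1 exprD (_ : q ^+ N = q ^+ (N - i) * q ^+ i); first ring.
by rewrite -exprD subnK.
Qed.

Lemma dom_gfS i N m : dom_gf q i.+1 N m =
  q ^+ (i * i.+1) * (qbinom q N%:Z i.+1%:Z * qbinom q m%:Z i.+1%:Z
     - q * qbinom q N%:Z i%:Z * qbinom q m%:Z i.+2%:Z).
Proof.
have e1 : ('C(i.+1, 2) + 'C(i.+1, 2) = i * i.+1)%N.
  by rewrite addnn bin2 -mul2n mulnC; elim: i => // i; lia.
have e2 : ('C(i, 2) + 'C(i.+2, 2) = i * i.+1 + 1)%N.
  by move: e1; rewrite !binS !bin0 !bin1; lia.
rewrite /dom_gf !elem_gfE mulrBr; congr (_ - _).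
  by rewrite -e1 exprD; ring.
have := congr1 (fun e => q ^+ e) e2; rewrite /= !exprD expr1 => e3.
by rewrite mulrACA e3; ring.
Qed.

(** Absorption writes all q-binomials as multiples of [N, i]_q, leaving an identity of rational
    functions. *)
Lemma dom_gf_narayana i N : (i < N)%N ->
  dom_gf q i.+1 N N = (qint q N.+1)^-1 *
    (q ^+ (i * i.+1) * qbinom q N.+1%:Z i.+1%:Z * qbinom q N.+1%:Z i.+2%:Z).
Proof.
move=> iN; rewrite dom_gfS.
have h1 := q_non_root i; have h2 := q_non_root i.+1; have h3 := q_non_root N.
have h4 := q_non_root 0; rewrite expr1 in h4.
have y : qbinom q N%:Z i.+1%:Z = (1 - q ^+ (N - i)) * qbinom q N%:Z i%:Z / (1 - q ^+ i.+1).
  by apply: (mulfI h1); rewrite qbinom_absorb_right 1?ltnW // [RHS]mulrC divfK.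
have z : qbinom q N%:Z i.+2%:Z = (1 - q ^+ (N - i.+1)) * qbinom q N%:Z i.+1%:Z / (1 - q ^+ i.+2).
  by apply: (mulfI h2); rewrite qbinom_absorb_right // [RHS]mulrC divfK.
have X : qbinom q N.+1%:Z i.+1%:Z = (1 - q ^+ N.+1) * qbinom q N%:Z i%:Z / (1 - q ^+ i.+1).
  by apply: (mulfI h1); rewrite qbinom_absorb_top // [RHS]mulrC divfK.
have Y : qbinom q N.+1%:Z i.+2%:Z = (1 - q ^+ N.+1) * qbinom q N%:Z i.+1%:Z / (1 - q ^+ i.+2).
  by apply: (mulfI h2); rewrite qbinom_absorb_top // [RHS]mulrC divfK.
rewrite X Y z y /qint.
(* Writing N = i + 1 + j removes truncated subtraction from the exponents, as [field] requires. *)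
have [j e] : exists j, N = (i.+1 + j)%N by exists (N - i.+1)%N; rewrite subnKC.
move: h1 h2 h3; rewrite e addKn addSnnS addKn !(exprS, exprD) => h1 h2 h3.
by field; rewrite h1 h2 h3 h4.
Qed.

End QBinomial.

(** * The two closed forms *)

Section ClosedForms.
Variable F : fieldType.
Variables (q t : F) (c : nat).
Hypothesis q_non_root : forall n, 1 - q ^+ n.+1 != 0.

Lemma ranked_gf_Cpoly m N : q != 0 -> (N <= m)%N ->
  ranked_gf q t c m (N + c) = Cpoly N.+1 q (t * q ^ (c%:Z - 1)).
Proof.
move=> q0 Nm; have -> : ranked_gf q t c m (N + c) = ranked_gf q t c N (N + c).
  by rewrite -(subnK Nm); elim: (m - N)%N => // r IH; rewrite addSn ranked_gf_stable //; lia.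
rewrite (@ranked_gf_dom _ _ _ _ _ _ N.+1) // big_nat_recl // expr0 mul1r.
rewrite /Cpoly big_add1 mulr_sumr; congr (_ + _); apply: eq_big_nat => i iN.
rewrite dom_gf_narayana // expfzDr // exprN1 -exprnP.
(* Splitting q^2 off q^(c+1) raises the exponent i(i+1) to the (i+1)(i+2) of [Cpoly]. *)
have -> : (t * q ^+ c.+1) ^+ i.+1 = (t * (q ^+ c / q)) ^+ i.+1 * q ^+ (i.+1 + i.+1).
  by rewrite addnn -mul2n exprM -exprMn [q ^+ c.+1]exprS; congr (_ ^+ _); field.
have -> : (i.+1 * i.+2 = i * i.+1 + (i.+1 + i.+1))%N by lia.
rewrite [in RHS]exprD; ring.
Qed.

(** After q-Pascal on [N+1, i+1]_q and [m+1, i+2]_q, the products [N, i]_q [m, i+1]_q cancel,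
    leaving q^(i+1) times the bracket of [dom_gfS]. *)
Lemma ranked_gf_rank_term m N : (m <= N)%N ->
  ranked_gf q t c m (N + c) =
  \sum_(0 <= i < m.+1) rank_term m (N + c) (1 - c%:Z) q t i.
Proof.
move=> mN; rewrite (@ranked_gf_dom _ _ _ _ _ _ m.+1) ?(leqW mN) //; apply: eq_bigr => i _.
rewrite /rank_term PoszD (_ : N%:Z + c%:Z + (1 - c%:Z) = N.+1%:Z); last by lia.
have succ_pred (j : nat) : j.+1%:Z - 1 = j%:Z by rewrite intS addrC addKr.
have pred_succ (j : nat) : j%:Z + 1 = j.+1%:Z by rewrite intS addrC.
rewrite succ_pred [m%:Z + 1]pred_succ.
case: i => [|i].
  (* The subtracted product has lower index -1, where [qbinom] is 0. *)
  by rewrite mul0r !qbinom0 // {1}/qbinom /= mul0r subr0 !mulr1.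
rewrite dom_gfS // succ_pred pred_succ !qbinom_pascal //.
have -> : i.+1%:Z * (i.+1%:Z - (1 - c%:Z)) = (i.+1 * (i + c))%:Z by lia.
rewrite -exprnP exprMn -exprM.
have -> : (c.+1 * i.+1 = c * i.+1 + i.+1)%N by lia.
have -> : (i.+1 * (i + c) = c * i.+1 + i * i.+1)%N by lia.
by rewrite !exprD [q ^+ i.+2]exprS; ring.
Qed.

End ClosedForms.

(** * Specialization to formal variables *)

Lemma qvar_neq0 : qvar != 0.
Proof. by rewrite tofrac_eq0 polyC_eq0 polyX_eq0. Qed.

Lemma qvar_non_root n : 1 - qvar ^+ n.+1 != 0.
Proof.
rewrite /qvar -tofracXn -tofrac1 -tofracB tofrac_eq0 -polyC_exp -polyCB polyC_eq0.
rewrite subr_eq0; apply/eqP => /(congr1 (fun p : {poly rat} => size p)).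
by rewrite size_polyXn size_poly1.
Qed.

Theorem theorem1p1 (m n : nat) (l : int) (hnl : - n%:Z <= l) (hl1 : l <= 1) :
  \sum_(s in ranked_partitions m n (1 - l))
     tvar ^+ durfee (parts s) * qvar ^+ sumn (parts s)
  = if l <= m%:Z - n%:Z
    then Cpoly (absz (n%:Z + l)%R) qvar (tvar * qvar ^ (- l))
    else \sum_(0 <= i < m.+1) rank_term m n l qvar tvar i.
Proof.
have [c el] : exists c : nat, l = 1 - c%:Z by exists `|1 - l|%N; lia.
rewrite {l hl1}el in hnl *.
rewrite (_ : 1 - (1 - c%:Z) = c%:Z); last by ring.
transitivity (ranked_gf qvar tvar c m n).
  by rewrite /ranked_gf /ranked_seqs big_map big_enum.
have [nc|[N ->]] : (n < c)%N \/ exists N, n = (N + c)%N.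
- by have [|cn] := ltnP n c; [left | right; exists (n - c)%N; rewrite subnK].
(* Here [hnl] forces c = n + 1, so n + l = 0: the first case applies, with C_0 = 1. *)
- rewrite ranked_gf_small 1?ltnW // ifT; last by lia.
  have -> : `|(n%:Z + (1 - c%:Z))%R|%N = 0%N by lia.
  by rewrite /Cpoly big_geq // mulr0 addr0.
have -> : `|((N + c)%:Z + (1 - c%:Z))%R|%N = N.+1 by lia.
(* With n = N + c the test reads N + 1 <= m, so its failure means m <= N. *)
case: ifP => h; last first.
  by apply: ranked_gf_rank_term; [exact: qvar_non_root | lia].
rewrite opprB; apply: ranked_gf_Cpoly; [exact: qvar_non_root | exact: qvar_neq0 | lia].
Qed.
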